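(* A bijective real-linear map $T\colon M_2(\mathbb F)\to M_2(\mathbb F)$ maps $\mathcal U_2(\mathbb F)$ into $\mathbb F\,\mathcal U_2(\mathbb F)$ if and only if $T(I)$ is a nonzero multiple of a matrix in $\mathcal U_2(\mathbb F)$ and the map $L(X)=T(I)^{-1}T(X)$ satisfies one of: (i) $\mathbb F=\mathbb R$ and $L(\mathbf V_1)=\mathbf V_1$, $L(\mathbf V_2)=\mathbf V_2$; (ii) $\mathbb F=\mathbb C$ and there are $U,V\in\mathcal U_2(\mathbb C)$ and $\mu\in\mathbb C\setminus\mathbb R$ such that the (unital) map $L'(X)=VL(UXU^* )V^*$ satisfies $L'(iI)=\mu I$ and, for $j=1,2,3$, $$L'(\Sigma_j)=a_j\Sigma_j+b_jI,\qquad L'(i\Sigma_j)=\mu L'(\Sigma_j),$$ for some real $a_1,a_2,a_3,b_1,b_2,b_3$ with $a_1\ge a_2\ge|a_3|>0$. Moreover, if in case (ii) $T$ is complex-linear then $\mu=i$.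
   Context: $\mathbb F$ is $\mathbb C$ or $\mathbb R$; $\mathcal U_2(\mathbb F)=\{A\in M_2(\mathbb F):A^*A=I\}$ with $A^*$ the conjugate transpose (transpose if real); $\mathbb F\,\mathcal U_2(\mathbb F)=\{\gamma U:\gamma\in\mathbb F, U\in\mathcal U_2(\mathbb F)\}$. $E_{ij}$ denotes the matrix unit. $\mathbf V_1=\mathrm{Span}_{\mathbb R}\{I_2,E_{12}-E_{21}\}$, $\mathbf V_2=\mathrm{Span}_{\mathbb R}\{E_{11}-E_{22},E_{12}+E_{21}\}$ (subspaces of $M_2(\mathbb R)$). $\Sigma_1=\begin{pmatrix}0&i\\ i&0\end{pmatrix}$, $\Sigma_2=\begin{pmatrix}0&1\\-1&0\end{pmatrix}$, $\Sigma_3=\begin{pmatrix}i&0\\0&-i\end{pmatrix}$. *)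

(* Defs.v *)
From HB Require Import structures.
From mathcomp Require Import all_boot all_order all_algebra.
From mathcomp Require Import complex reals.
Set Implicit Arguments. Unset Strict Implicit. Unset Printing Implicit Defensive.
Import Order.TTheory GRing.Theory Num.Theory.
Local Open Scope ring_scope.
Local Open Scope complex_scope.

Section Defs.
Variable R : realType.
Local Notation C := R[i].

Definition E2 {K : pzRingType} (i j : 'I_2) : 'M[K]_2 := delta_mx i j.

Definition adjC (A : 'M[C]_2) : 'M[C]_2 := map_mx conjc (trmx A).

Definition unitaryR (A : 'M[R]_2) : Prop := trmx A *m A = 1%:M.
Definition unitaryC (A : 'M[C]_2) : Prop := adjC A *m A = 1%:M.

Definition inFUR (A : 'M[R]_2) : Prop :=
  exists (g : R) (W : 'M[R]_2), unitaryR W /\ A = g *: W.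
Definition inFUC (A : 'M[C]_2) : Prop :=
  exists (g : C) (W : 'M[C]_2), unitaryC W /\ A = g *: W.

Definition nzFUR (A : 'M[R]_2) : Prop :=
  exists (g : R) (W : 'M[R]_2), g != 0 /\ unitaryR W /\ A = g *: W.
Definition nzFUC (A : 'M[C]_2) : Prop :=
  exists (g : C) (W : 'M[C]_2), g != 0 /\ unitaryC W /\ A = g *: W.

Definition realLinearR (T : 'M[R]_2 -> 'M[R]_2) : Prop :=
  forall (r : R) (X Y : 'M[R]_2), T (r *: X + Y) = r *: T X + T Y.
Definition realLinearC (T : 'M[C]_2 -> 'M[C]_2) : Prop :=
  forall (r : R) (X Y : 'M[C]_2), T (r%:C *: X + Y) = r%:C *: T X + T Y.
Definition complexLinearC (T : 'M[C]_2 -> 'M[C]_2) : Prop :=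
  forall (c : C) (X Y : 'M[C]_2), T (c *: X + Y) = c *: T X + T Y.

Definition preservesR (T : 'M[R]_2 -> 'M[R]_2) : Prop :=
  forall A, unitaryR A -> inFUR (T A).
Definition preservesC (T : 'M[C]_2 -> 'M[C]_2) : Prop :=
  forall A, unitaryC A -> inFUC (T A).

Definition LmapR (T : 'M[R]_2 -> 'M[R]_2) (X : 'M[R]_2) : 'M[R]_2 :=
  invmx (T 1%:M) *m T X.
Definition LmapC (T : 'M[C]_2 -> 'M[C]_2) (X : 'M[C]_2) : 'M[C]_2 :=
  invmx (T 1%:M) *m T X.

Definition V1 (X : 'M[R]_2) : Prop :=
  exists a b : R, X = a *: 1%:M + b *: (E2 0 1 - E2 1 0).
Definition V2 (X : 'M[R]_2) : Prop :=
  exists a b : R, X = a *: (E2 0 0 - E2 1 1) + b *: (E2 0 1 + E2 1 0).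

Definition mapsOnto (L : 'M[R]_2 -> 'M[R]_2) (V : 'M[R]_2 -> Prop) : Prop :=
  (forall X, V X -> V (L X)) /\ (forall Y, V Y -> exists X, V X /\ L X = Y).

Definition Sigma1 : 'M[C]_2 := 'i *: (E2 0 1 + E2 1 0).
Definition Sigma2 : 'M[C]_2 := E2 0 1 - E2 1 0.
Definition Sigma3 : 'M[C]_2 := 'i *: (E2 0 0 - E2 1 1).

Definition Lprime (T : 'M[C]_2 -> 'M[C]_2) (U V : 'M[C]_2) (X : 'M[C]_2)
  : 'M[C]_2 := V *m LmapC T (U *m X *m adjC U) *m adjC V.

Definition condII_with (T : 'M[C]_2 -> 'M[C]_2) (U V : 'M[C]_2) (mu : C)
  : Prop :=
  unitaryC U /\ unitaryC V /\ 'Im mu != 0 /\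
  Lprime T U V ('i *: 1%:M) = mu *: 1%:M /\
  exists a1 a2 a3 b1 b2 b3 : R,
    Lprime T U V Sigma1 = a1%:C *: Sigma1 + b1%:C *: 1%:M /\
    Lprime T U V Sigma2 = a2%:C *: Sigma2 + b2%:C *: 1%:M /\
    Lprime T U V Sigma3 = a3%:C *: Sigma3 + b3%:C *: 1%:M /\
    Lprime T U V ('i *: Sigma1) = mu *: Lprime T U V Sigma1 /\
    Lprime T U V ('i *: Sigma2) = mu *: Lprime T U V Sigma2 /\
    Lprime T U V ('i *: Sigma3) = mu *: Lprime T U V Sigma3 /\
    a2 <= a1 /\ `|a3| <= a2 /\ 0 < `|a3|.

Definition condII (T : 'M[C]_2 -> 'M[C]_2) : Prop :=
  exists (U V : 'M[C]_2) (mu : C), condII_with T U V mu.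

End Defs.

(* Main.v *)
Require Import Defs.
From mathcomp Require Import all_boot all_order all_algebra perm fingroup.
From mathcomp Require Import complex reals ring lra.
Import Order.TTheory GRing.Theory Num.Theory.
Set Implicit Arguments. Unset Strict Implicit. Unset Printing Implicit Defensive.
Local Open Scope ring_scope.
Local Open Scope complex_scope.

(** Real case: the real multiples of orthogonal matrices form [V1 \/ V2], and a
    linear bijection preserving a union of two complementary subspaces and fixing
    a vector of the first one preserves each of them.

    Complex case: let H be the real span of I, Sigma1, Sigma2, Sigma3 (the
    quaternions).  Then M_2(C) = C (x)_R H and C U_2(C) = { g q : g in C, q in H }
    is the set of tensors of rank at most one in R^2 (x) R^4.  A unital
    bijection L preserving this set must be a product A (x) B: since
    L(1) + L(q) and L(q) both have rank at most one, L(q) lies in H or in C, and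
    C is too small, so L(H) = H; similarly L(i q) is a multiple of L(q), by a
    factor mu that does not depend on q.  On trace-free quaternions B is given
    modulo R by an invertible 3x3 matrix, whose singular value decomposition
    with factors in SO(3), lifted to conjugations by elements of SU(2), is the
    normal form. *)

(** * Singular values of real 3x3 matrices *)

Section Spectral.
Variable R : realType.

Lemma mul_rVtr n (v : 'rV[R]_n) : (v *m v^T) 0 0 = \sum_i v 0 i ^+ 2.
Proof. by rewrite mxE; apply: eq_bigr => i _; rewrite mxE expr2. Qed.

Lemma mul_rVtr_ge0 n (v : 'rV[R]_n) : 0 <= (v *m v^T) 0 0.
Proof. by rewrite mul_rVtr sumr_ge0 // => i _; rewrite sqr_ge0. Qed.

Lemma mul_rVtr_eq0 n (v : 'rV[R]_n) : ((v *m v^T) 0 0 == 0) = (v == 0).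
Proof.
apply/idP/eqP => [|->]; last by rewrite mul0mx mxE.
rewrite mul_rVtr psumr_eq0 => [|i _]; last exact: sqr_ge0.
move/allP=> h; apply/rowP => i; rewrite mxE; apply/eqP.
by have := h i (mem_index_enum _); rewrite sqrf_eq0.
Qed.

(** Over the complex numbers the matrix is hermitian, so its spectral values are real. Such a value
    is a root of the real characteristic polynomial, hence has a real eigenvector, which is then
    normalized. *)
Lemma symmetric_eigenvector n (S : 'M[R]_n.+1) : S^T = S ->
  exists (v : 'rV[R]_n.+1) (a : R), v *m v^T = 1%:M /\ v *m S = a *: v.
Proof.
move=> St; pose A := map_mx (real_complex R) S.
have Ah : A \is hermsymmx.
  apply/is_hermitianmxP; rewrite expr0 scale1r; apply/matrixP => i j.
  by rewrite !mxE conj_Creal ?complex_real // -{1}St mxE.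
have An := hermitian_normalmx Ah.
have /mxOverP/(_ 0 0)/complex_realP[a ea] := hermitian_spectral_diag_real Ah.
have eigA : eigenvalue A a%:C.
  apply/eigenvalueP; exists (row 0 (spectralmx A)).
    have := orthomx_spectralP An.
    move/(congr1 (mulmx (spectralmx A))).
    rewrite !mulmxA mulmxV ?spectral_unit // mul1mx => /(congr1 (row 0)).
    rewrite !row_mul => ->; rewrite row_diag_mx -scalemxAl -rowE ea.
    by [].
  apply/eqP => r0; have := spectral_unit A.
  rewrite -row_free_unit => /row_freeP[B /(congr1 (row 0))].
  rewrite row_mul r0 mul0mx => /rowP/(_ 0).
  by rewrite !mxE eqxx => /eqP; rewrite eq_sym oner_eq0.
have: eigenvalue S a.
  by move: eigA; rewrite !eigenvalue_root_char -map_char_poly fmorph_root.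
case/eigenvalueP => w ew w0.
have nw : 0 < (w *m w^T) 0 0 by rewrite lt_def mul_rVtr_eq0 w0 mul_rVtr_ge0.
set s := Num.sqrt ((w *m w^T) 0 0).
have s0 : s != 0 by rewrite gt_eqF // sqrtr_gt0.
exists (s^-1 *: w), a; split.
  rewrite linearZ /= -scalemxAl -scalemxAr scalerA.
  apply/matrixP => i j; rewrite !ord1 mxE.
  by rewrite -(sqr_sqrtr (ltW nw)) -/s mxE expr2 mulrA mulfVK // mulVf.
by rewrite -scalemxAl ew !scalerA mulrC.
Qed.

(* Householder reflection exchanging [v] and the first basis vector. *)
Lemma orthogonal_first_row n (v : 'rV[R]_n.+1) : v *m v^T = 1%:M ->
  exists Q : 'M[R]_n.+1, Q *m Q^T = 1%:M /\ row 0 Q = v.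
Proof.
move=> v1; pose e : 'rV[R]_n.+1 := delta_mx 0 0.
have [ev|ev] := eqVneq (e - v) 0.
  exists 1%:M; rewrite trmx1 mulmx1; split=> //.
  by rewrite row1 -/e; apply/eqP; rewrite -subr_eq0 ev.
set w := e - v; set c := (w *m w^T) 0 0.
have c0 : c != 0 by rewrite mul_rVtr_eq0.
have wwT : w *m w^T = c%:M by rewrite [LHS]mx11_scalar.
have ee : e *m e^T = 1%:M.
  by rewrite trmx_delta mul_delta_mx; apply/matrixP => i j; rewrite !ord1 !mxE.
(* As [e] and [v] have the same norm, [|e - v|^2 = 2 (1 - e.v)]; this is what makes the reflection
   send [e] exactly to [v]. *)
have ew : 2 *: (e *m w^T) = c%:M.
  have ve : v *m e^T = e *m v^T.
    rewrite -[RHS]trmxK trmx_mul trmxK; apply/matrixP => i j.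
    by rewrite !ord1 [RHS]mxE.
  rewrite -wwT /w !linearB /= !mulmxBl ee v1 ve scaler_nat mulr2n.
  by rewrite scaler_nat mulr2n opprB opprD addrACA.
pose Q := 1%:M - (2 / c) *: (w^T *m w).
have Qt : Q^T = Q by rewrite /Q linearB /= linearZ /= trmx_mul trmxK trmx1.
have QW : Q *m (w^T *m w) = - (w^T *m w).
  rewrite /Q mulmxBl mul1mx -scalemxAl -mulmxA (mulmxA w) wwT mul_scalar_mx.
  by rewrite -scalemxAr scalerA divfK // scaler_nat mulr2n opprD addNKr.
exists Q; split.
  by rewrite Qt {2}/Q mulmxBr mulmx1 -scalemxAr QW scalerN opprK /Q subrK.
have -> : row 0 Q = e - c^-1 *: (2 *: (e *m w^T) *m w).
  rewrite rowE -/e /Q mulmxBr mulmx1 -scalemxAr mulmxA -scalemxAl scalerA.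
  by rewrite mulrC.
by rewrite ew mul_scalar_mx scalerA mulVf // scale1r opprB addrC subrK.
Qed.

(** Deflation: in an orthonormal basis starting with an eigenvector, symmetry clears the first row
    and column off the diagonal, and the induction hypothesis applies to the remaining block. *)
Lemma real_spectral n (S : 'M[R]_n) : S^T = S ->
  exists (P : 'M[R]_n) (d : 'rV[R]_n), P *m P^T = 1%:M /\ P *m S *m P^T = diag_mx d.
Proof.
elim: n S => [|n IH] S St.
  by exists 0, 0; split; apply/matrixP => -[].
have [v [a [v1 vS]]] := symmetric_eigenvector St.
have [Q [QQ Qv]] := orthogonal_first_row v1.
have [S1 S1E] : exists S1 : 'M_(1 + n), S1 = Q *m S *m Q^T by eexists.
have S1t : S1^T = S1 by rewrite S1E !trmx_mul trmxK St mulmxA.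
have rS1 : row 0 S1 = a *: delta_mx 0 0.
  by rewrite S1E !row_mul Qv vS -scalemxAl -Qv -row_mul QQ row1.
have ur : ursubmx S1 = 0.
  apply/matrixP => i j; rewrite !mxE ord1.
  move/rowP/(_ (rshift 1 j)): rS1; rewrite !mxE mulr0 => <-.
  by congr (S1 _ _); apply: val_inj.
have ul : ulsubmx S1 = a%:M.
  apply/matrixP => i j; rewrite !mxE !ord1.
  by move/rowP/(_ 0): rS1; rewrite !mxE mulr1 => <-; congr (S1 _ _); apply: val_inj.
have dl : dlsubmx S1 = 0 by rewrite -[S1]S1t -trmx_ursub ur trmx0.
have drt : (drsubmx S1)^T = drsubmx S1 by rewrite trmx_drsub S1t.
have [P [d [PP PS]]] := IH _ drt.
pose B : 'M_(1 + n) := block_mx 1%:M 0 0 P.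
have BB : B *m B^T = 1%:M.
  rewrite tr_block_mx !trmx0 trmx1 mulmx_block PP.
  by rewrite !mulmx0 !mul0mx !addr0 !add0r mulmx1 -scalar_mx_block.
have BS : B *m S1 *m B^T = diag_mx (row_mx a%:M d).
  rewrite -[S1]submxK ul ur dl tr_block_mx !trmx0 trmx1 !mulmx_block.
  rewrite !mulmx0 !mul0mx !addr0 !add0r mulmx1 mul1mx PS.
  rewrite diag_mx_row !mul0mx; congr block_mx.
  by apply/matrixP => i j; rewrite !ord1 !mxE.
exists (B *m Q : 'M_n.+1), (row_mx a%:M d); rewrite trmx_mul; split.
  by rewrite mulmxA -(mulmxA B Q) QQ mulmx1.
by rewrite -BS S1E !mulmxA.
Qed.

Lemma real_spectral_sorted n (S : 'M[R]_n) : S^T = S ->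
  exists (P : 'M[R]_n) (d : 'rV[R]_n),
    [/\ P *m P^T = 1%:M, P *m S *m P^T = diag_mx d
      & forall i j : 'I_n, (i <= j)%N -> d 0 j <= d 0 i].
Proof.
move=> /real_spectral[P [d [PP PS]]].
pose t := [tuple d 0 i | i < n].
have /tuple_permP[s es] : perm_eq (sort >=%R t) t by rewrite perm_sort.
exists (row_perm s P), (col_perm s d); split.
- have := congr1 (col_perm s) (congr1 (row_perm s) PP).
  rewrite tr_row_perm !row_permE !col_permE !mulmxA => ->.
  by rewrite mulmx1 -perm_mxM mulgV perm_mx1.
- have := congr1 (row_perm s) (congr1 (col_perm s) PS).
  rewrite tr_row_perm [in LHS]row_permE [in LHS]col_permE.
  rewrite [row_perm s P]row_permE [col_perm s P^T]col_permE !mulmxA => ->.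
  by apply/matrixP => i j; rewrite !mxE (inj_eq perm_inj).
- move=> i j le_ij; rewrite !mxE.
  have dE k : d 0 (s k) = nth 0 (sort >=%R t) k.
    rewrite es (nth_map k) ?size_enum_ord // nth_ord_enum tnth_mktuple //.
  rewrite !dE; apply: (@sorted_leq_nth _ >=%R _ _ _ _ _ _) => //.
  - by move=> ? ? ? h1 h2; apply: le_trans h2 h1.
  - by move=> x; rewrite /= lexx.
  - by apply: sort_sorted => x y; rewrite /= le_total.
  - by rewrite inE size_sort size_tuple.
  - by rewrite inE size_sort size_tuple.
Qed.

(** Diagonalize [M *m M^T] by [P]: the rows of [P *m M] are then orthogonal, and dividing them by
    their norms gives an orthogonal factor. Both factors are forced into SO(3), at the price of a
    possibly negative last singular value. *)
Lemma svd3 (M : 'M[R]_3) : M \in unitmx ->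
  exists (P Q : 'M[R]_3) (d : 'rV[R]_3),
    [/\ P *m P^T = 1%:M /\ \det P = 1, Q *m Q^T = 1%:M /\ \det Q = 1,
        P *m M = diag_mx d *m Q
      & [/\ d 0 1 <= d 0 0, `|d 0 2| <= d 0 1 & 0 < `|d 0 2|]].
Proof.
move=> uM.
have St : (M *m M^T)^T = M *m M^T by rewrite trmx_mul trmxK.
have [P [d [PP PS dle]]] : exists (P : 'M[R]_3) (d : 'rV[R]_3),
    [/\ P *m P^T = 1%:M /\ \det P = 1, P *m (M *m M^T) *m P^T = diag_mx d
      & forall i j : 'I_3, (i <= j)%N -> d 0 j <= d 0 i].
  have [P [d [PP PS dle]]] := real_spectral_sorted St.
  have : \det P ^+ 2 = 1 by rewrite expr2 -{2}det_tr -det_mulmx PP det1.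
  move/eqP; rewrite sqrf_eq1 => /orP[]/eqP dP; first by exists P, d.
  (* The dimension 3 is odd, so negating [P] flips its determinant and leaves the conjugation
     unchanged. *)
  exists (- P), d; rewrite linearN /= !mulNmx !mulmxN !opprK; split=> //.
  by rewrite -scaleN1r detZ dP exprS sqrrN expr1n mulr1 mulrNN mulr1.
pose N := P *m M.
have NN : N *m N^T = diag_mx d by rewrite /N trmx_mul -PS !mulmxA.
have uN : N \in unitmx by rewrite unitmx_mul uM andbT unitmxE (proj2 PP) unitr1.
(* [d 0 i] is the squared norm of row [i] of the invertible matrix [N]. *)
have d0 i : 0 < d 0 i.
  have rN : (row i N *m (row i N)^T) 0 0 = d 0 i.
    rewrite mul_rVtr; move/matrixP/(_ i i): NN.
    rewrite mxE [in RHS]mxE eqxx mulr1n => <-; apply: eq_bigr => k _.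
    by rewrite [row i N 0 k]mxE [N^T k i]mxE expr2.
  rewrite -rN lt_def mul_rVtr_ge0 mul_rVtr_eq0 andbT; apply/eqP => r0.
  have : row i (N *m invmx N) = 0 by rewrite row_mul r0 mul0mx.
  rewrite mulmxV // => /rowP/(_ i); rewrite !mxE eqxx => /eqP.
  by rewrite oner_eq0.
pose r : 'rV[R]_3 := \row_i Num.sqrt (d 0 i).
pose r' : 'rV[R]_3 := \row_i (Num.sqrt (d 0 i))^-1.
have s0 i : 0 < Num.sqrt (d 0 i) by rewrite sqrtr_gt0.
have rr : diag_mx r *m diag_mx r' = 1%:M.
  rewrite mulmx_diag -diag_const_mx; congr diag_mx; apply/rowP => i.
  by rewrite !mxE divff // gt_eqF.
pose Q := diag_mx r' *m N.
have QQ : Q *m Q^T = 1%:M.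
  rewrite trmx_mul mulmxA -(mulmxA _ N) NN tr_diag_mx !mulmx_diag -diag_const_mx.
  congr diag_mx; apply/rowP => i; rewrite !mxE.
  rewrite -{2}[d 0 i]sqr_sqrtr ?ltW // expr2 mulKf ?gt_eqF // divff // gt_eqF //.
have NQ : N = diag_mx r *m Q by rewrite /Q mulmxA rr mul1mx.
have dQ : \det Q ^+ 2 = 1 by rewrite expr2 -{2}det_tr -det_mulmx QQ det1.
(* The sign [\det Q] is moved from the last row of [Q] to the last, smallest singular value. *)
pose j : 'rV[R]_3 := \row_i (if i == 2 then \det Q else 1).
have jj : diag_mx j *m diag_mx j = 1%:M.
  rewrite mulmx_diag -diag_const_mx; congr diag_mx; apply/rowP => i.
  by rewrite !mxE; case: ifP => _; rewrite ?mulr1 // -expr2.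
exists P, (diag_mx j *m Q), (\row_i (r 0 i * j 0 i)); split=> //.
- rewrite trmx_mul mulmxA -(mulmxA _ Q) QQ mulmx1 tr_diag_mx; split=> //.
  rewrite det_mulmx det_diag !big_ord_recr big_ord0 !mxE /=.
  by rewrite !mul1r -expr2.
- rewrite -/N {1}NQ -mulmx_diag mulmxA -(mulmxA (diag_mx r)) jj mulmx1 //.
- have nQ : `|\det Q| = 1.
    by move/eqP: dQ; rewrite sqrf_eq1 => /orP[]/eqP->; rewrite ?normrN normr1.
  rewrite !mxE /= !mulr1 normrM nQ mulr1 gtr0_norm //; split=> //;
    by apply: ler_wsqrtr; exact: dle.
Qed.
End Spectral.

(** * Quaternions in M_2(C) *)

Lemma mx2P (K : Type) (A B : 'M[K]_2) : A 0 0 = B 0 0 -> A 0 1 = B 0 1 ->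
  A 1 0 = B 1 0 -> A 1 1 = B 1 1 -> A = B.
Proof.
move=> h00 h01 h10 h11; apply/matrixP.
have I2 (i : 'I_2) : i = 0 \/ i = 1.
  by case: i => [[|[|?]] ?] //; [left | right]; apply: val_inj.
by move=> i j; case: (I2 i) => ->; case: (I2 j) => ->.
Qed.

Lemma sum2E (V : nmodType) (F : 'I_2 -> V) : \sum_k F k = F 0 + F 1.
Proof.
rewrite !big_ord_recr big_ord0 /= add0r.
by congr (F _ + F _); apply: val_inj.
Qed.

Definition mx22 (K : Type) (p q r s : K) : 'M[K]_2 :=
  \matrix_(i, j) if i == 0 then if j == 0 then p else q
                 else if j == 0 then r else s.

Lemma mx22_eta (K : Type) (A : 'M[K]_2) :
  A = mx22 (A 0 0) (A 0 1) (A 1 0) (A 1 1).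
Proof. by apply: mx2P; rewrite mxE. Qed.

Lemma mx22_inj (K : Type) (p q r s p' q' r' s' : K) :
  mx22 p q r s = mx22 p' q' r' s' -> [/\ p = p', q = q', r = r' & s = s'].
Proof.
move=> /matrixP e; have := (e 0 0, e 0 1, e 1 0, e 1 1).
by rewrite !mxE /= => -[[[-> ->] ->] ->].
Qed.

Lemma mx22_1 (K : pzRingType) : 1%:M = mx22 1 0 0 1 :> 'M[K]_2.
Proof. by apply: mx2P; rewrite !mxE. Qed.

Lemma mx22Z (K : pzRingType) (c p q r s : K) :
  c *: mx22 p q r s = mx22 (c * p) (c * q) (c * r) (c * s).
Proof. by apply: mx2P; rewrite !mxE. Qed.

Lemma mx22D (K : pzRingType) (p q r s p' q' r' s' : K) :
  mx22 p q r s + mx22 p' q' r' s' = mx22 (p + p') (q + q') (r + r') (s + s').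
Proof. by apply: mx2P; rewrite !mxE. Qed.

Lemma mx22M (K : pzRingType) (p q r s p' q' r' s' : K) :
  mx22 p q r s *m mx22 p' q' r' s' =
  mx22 (p * p' + q * r') (p * q' + q * s') (r * p' + s * r') (r * q' + s * s').
Proof. by apply: mx2P; rewrite mxE sum2E !mxE. Qed.

Lemma sum3E (V : nmodType) (F : 'I_3 -> V) : \sum_k F k = F 0 + F 1 + F 2.
Proof.
rewrite !big_ord_recr big_ord0 /= add0r.
by congr (F _ + F _ + F _); apply: val_inj.
Qed.

Local Notation "z ^c" := (conjc z).

Variant ord3_spec : 'I_3 -> Prop :=
  | Ord3_0 : ord3_spec 0
  | Ord3_1 : ord3_spec 1
  | Ord3_2 : ord3_spec 2.

Lemma ord3P (k : 'I_3) : ord3_spec k.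
Proof.
case: k => [[|[|[|?]]] Hk] //.
- by rewrite (_ : Ordinal Hk = 0); [constructor | apply: val_inj].
- by rewrite (_ : Ordinal Hk = 1); [constructor | apply: val_inj].
- by rewrite (_ : Ordinal Hk = 2); [constructor | apply: val_inj].
Qed.

Section Quaternions.
Variable R : realType.
Local Notation C := R[i].
Local Notation M2 := 'M[C]_2.
Implicit Types (A B Z : M2) (v w : 'rV[R]_3).

Lemma adjCE A i j : adjC A i j = (A j i)^c.
Proof. by rewrite !mxE. Qed.

Lemma adjCM A B : adjC (A *m B) = adjC B *m adjC A.
Proof. by rewrite /adjC trmx_mul map_mxM. Qed.

Lemma adjCK A : adjC (adjC A) = A.
Proof. by apply/matrixP => i j; rewrite !adjCE conjcK. Qed.

Lemma adjCZ c A : adjC (c *: A) = c^c *: adjC A.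
Proof. by apply/matrixP => i j; rewrite adjCE !mxE rmorphM. Qed.

Lemma unitaryC_adj A : unitaryC A -> A *m adjC A = 1%:M.
Proof. exact: mulmx1C. Qed.

Lemma unitaryC1 : unitaryC (1%:M : M2).
Proof. by rewrite /unitaryC mulmx1 /adjC trmx1 map_mx1. Qed.

Lemma unitaryCM A B : unitaryC A -> unitaryC B -> unitaryC (A *m B).
Proof.
by move=> uA uB; rewrite /unitaryC adjCM mulmxA -(mulmxA _ _ A) uA mulmx1.
Qed.

Lemma unitaryC_adjC A : unitaryC A -> unitaryC (adjC A).
Proof. by move=> uA; rewrite /unitaryC adjCK unitaryC_adj. Qed.

Lemma unitaryCZ c A : c^c * c = 1 -> unitaryC A -> unitaryC (c *: A).
Proof.
by move=> c1 uA; rewrite /unitaryC adjCZ -scalemxAl -scalemxAr uA scalerA c1 scale1r.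
Qed.

Lemma inFUC_mul A B : inFUC A -> inFUC B -> inFUC (A *m B).
Proof.
move=> [g [U [uU ->]]] [h [V [uV ->]]]; exists (g * h), (U *m V); split.
  exact: unitaryCM.
by rewrite -scalemxAl -scalemxAr scalerA.
Qed.

(* Indices start at 0: [Sg k] is the paper's Sigma_(k+1). *)
Definition Sg (k : 'I_3) : M2 :=
  if k == 0 then Sigma1 R else if k == 1 then Sigma2 R else Sigma3 R.

(** The quaternion with real part [a] and imaginary part [v]; keeping [v] as a row vector lets 3x3
    matrices act on imaginary parts. *)
Definition Hq (a : R) v : M2 := a%:C *: 1%:M + \sum_k (v 0 k)%:C *: Sg k.

Lemma Sg0E : Sg 0 = mx22 0 'i 'i 0.
Proof. by apply: mx2P; rewrite !mxE /=; simpc. Qed.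

Lemma Sg1E : Sg 1 = mx22 0 1 (-1) 0.
Proof. by apply: mx2P; rewrite !mxE /=; simpc. Qed.

Lemma Sg2E : Sg 2 = mx22 'i 0 0 (- 'i).
Proof. by apply: mx2P; rewrite !mxE /=; simpc. Qed.

Lemma HqE a v : Hq a v = mx22 (a +i* v 0 2) (v 0 1 +i* v 0 0)
                              (- v 0 1 +i* v 0 0) (a -i* v 0 2).
Proof.
rewrite /Hq sum3E Sg0E Sg1E Sg2E mx22_1 !mx22Z !mx22D.
by congr mx22; simpc.
Qed.

Lemma adjC_mx22 (p q r s : C) : adjC (mx22 p q r s) = mx22 p^c r^c q^c s^c.
Proof. by apply: mx2P; rewrite !mxE. Qed.

Lemma Sg_Hq k : Sg k = Hq 0 (delta_mx 0 k).
Proof.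
rewrite /Hq scale0r add0r (bigD1 k) //= mxE !eqxx scale1r big1 ?addr0 // => j jk.
by rewrite mxE (negPf jk) andbF scale0r.
Qed.

Lemma Hq_one : Hq 1 0 = 1%:M.
Proof.
by rewrite /Hq scale1r big1 ?addr0 // => k _; rewrite mxE scale0r.
Qed.

Lemma HqZ (r a : R) v : r%:C *: Hq a v = Hq (r * a) (r *: v).
Proof.
rewrite /Hq scalerDr scalerA -rmorphM scaler_sumr; congr (_ + _).
by apply: eq_bigr => k _; rewrite mxE rmorphM scalerA.
Qed.

Lemma HqD a v b w : Hq a v + Hq b w = Hq (a + b) (v + w).
Proof.
rewrite /Hq addrACA -scalerDl -rmorphD -big_split; congr (_ + _).
by apply: eq_bigr => k _; rewrite mxE rmorphD scalerDl.
Qed.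

Lemma Hq00 : Hq 0 0 = 0.
Proof. by rewrite /Hq scale0r add0r big1 // => k _; rewrite mxE scale0r. Qed.

Definition vec3 (x y z : R) : 'rV[R]_3 :=
  \row_k (if k == 0 then x else if k == 1 then y else z).

Lemma vec3E x y z :
  (vec3 x y z 0 0 = x) * (vec3 x y z 0 1 = y) * (vec3 x y z 0 2 = z).
Proof. by rewrite !mxE. Qed.

Lemma rV3P v w : v 0 0 = w 0 0 -> v 0 1 = w 0 1 -> v 0 2 = w 0 2 -> v = w.
Proof.
by move=> q0 q1 q2; apply/rowP => k; have [] := ord3P k.
Qed.

Lemma mx22_Hq (p q : C) : exists a v, mx22 p q (- q^c) p^c = Hq a v.
Proof.
case: p q => [x0 y0] [x1 y1]; exists x0, (vec3 y1 x1 y0).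
by rewrite HqE !vec3E; congr mx22; simpc.
Qed.

(** The sum H + iH is direct, so equalities in M_2(C) can be read off in real coordinates. *)
Lemma Hq_coords a v b w a' v' b' w' :
  Hq a v + 'i *: Hq b w = Hq a' v' + 'i *: Hq b' w' ->
  [/\ a = a', v = v', b = b' & w = w'].
Proof.
rewrite !HqE !mx22Z !mx22D => e; have [] := mx22_inj e.
simpc; move=> [p1 p2] [p3 p4] [p5 p6] [p7 p8].
by split; try apply: rV3P; lra.
Qed.

Lemma HqM a v b w : exists c x, Hq a v *m Hq b w = Hq c x.
Proof.
rewrite !HqE mx22M.
set p := _ + _ * (- w 0 1 +i* w 0 0); set q := _ + _ * (b -i* w 0 2).
have [c [x e]] := mx22_Hq p q; exists c, x; rewrite -e.
by congr mx22; rewrite /p /q; simpc; congr Complex; ring.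
Qed.

Lemma sqr_norm_rV3 v : (v *m v^T) 0 0 = v 0 0 ^+ 2 + v 0 1 ^+ 2 + v 0 2 ^+ 2.
Proof. by rewrite mul_rVtr sum3E. Qed.

Lemma adjC_Hq_mul a v :
  adjC (Hq a v) *m Hq a v = (a ^+ 2 + (v *m v^T) 0 0)%:C *: 1%:M.
Proof.
rewrite HqE adjC_mx22 mx22M sqr_norm_rV3 mx22_1 mx22Z.
by congr mx22; simpc; congr Complex; ring.
Qed.

Lemma Hq_norm_gt0 a v : Hq a v != 0 -> 0 < a ^+ 2 + (v *m v^T) 0 0.
Proof.
move=> n0; rewrite lt_def addr_ge0 ?sqr_ge0 ?mul_rVtr_ge0 // andbT.
apply: contraNneq n0 => /eqP; rewrite paddr_eq0 ?sqr_ge0 ?mul_rVtr_ge0 //.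
by rewrite sqrf_eq0 mul_rVtr_eq0 => /andP[/eqP-> /eqP->]; rewrite Hq00.
Qed.

Lemma Hq_normalize a v : Hq a v != 0 ->
  exists r : R, r != 0 /\ unitaryC (r%:C *: Hq a v).
Proof.
move=> /Hq_norm_gt0 N0; set N := _ + _ in N0.
exists (Num.sqrt N)^-1; rewrite invr_eq0 gt_eqF ?sqrtr_gt0 //; split=> //.
rewrite /unitaryC adjCZ -scalemxAl -scalemxAr adjC_Hq_mul -/N !scalerA.
have -> (x : R) : (x%:C)^c = x%:C by simpc.
rewrite -!rmorphM -{3}(sqr_sqrtr (ltW N0)) expr2.
rewrite mulrA mulfVK ?mulVf ?scale1r // gt_eqF ?sqrtr_gt0 //.
Qed.

(* With D the determinant, [h *: A] is a quaternion as soon as [h * D = h^c]. *)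
Lemma unitary_Hq A : unitaryC A -> exists g a v, A = g *: Hq a v.
Proof.
move=> uA; have := unitaryC_adj uA.
rewrite [A]mx22_eta; move: (A 0 0) (A 0 1) (A 1 0) (A 1 1) => p q r s.
rewrite adjC_mx22 mx22M mx22_1 => uA'; have [q00 q01 q10 q11] := mx22_inj uA'.
pose D := p * s - q * r.
(* Cramer's rule: the inverse of [A] is its adjoint, so the second row of [A] is determined by the
   first one and [D]. *)
have e11 : s = D * p^c.
  rewrite /D; transitivity (s * (p * p^c + q * q^c)
    - q * (r * p^c + s * q^c)); last by ring.
  by rewrite q00 q10; ring.
have e10 : r = - (D * q^c).
  rewrite /D; transitivity (r * (p * p^c + q * q^c)
    - p * (r * p^c + s * q^c)); last by ring.
  by rewrite q00 q10; ring.
have DD : D * D^c = 1.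
  transitivity (s * s^c + r * r^c); last by rewrite addrC.
  rewrite e11 e10 rmorphN !rmorphM /= !conjcK mulrNN.
  transitivity (D * D^c * (p * p^c + q * q^c)); last by ring.
  by rewrite q00 mulr1.
(* Since [D] has modulus 1, [1 + D^c] works unless it vanishes; in that case [D = -1] and ['i]
   works. *)
have [h h0 hD] : exists2 h, h != 0 & h * D = h^c.
  have [D1|D1] := eqVneq D (-1).
    exists 'i; rewrite ?D1 ?mulrN1; simpc; rewrite //.
    by rewrite eq_complex /= oner_eq0 andbF.
  exists (1 + D^c); last first.
    by rewrite mulrDl mul1r [_ * D]mulrC DD rmorphD rmorph1 /= conjcK addrC.
  apply: contraNneq D1 => /eqP; rewrite addrC addr_eq0 => /eqP e.
  by rewrite -[D]conjcK e; apply/eqP; simpc.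
have [a [v e]] := mx22_Hq (h * p) (h * q).
exists h^-1, a, v; rewrite -e !rmorphM /= -hD !mx22Z.
by rewrite e10 e11; congr mx22; field.
Qed.

Lemma inFUC_Hq Z : inFUC Z <-> exists g a v, Z = g *: Hq a v.
Proof.
split=> [[g [A [/unitary_Hq[h [a [v ->]]] ->]]] | [g [a [v ->]]]].
  by exists (g * h), a, v; rewrite scalerA.
have [->|/Hq_normalize[r [r0 ru]]] := eqVneq (Hq a v) 0.
  by exists 0, 1%:M; rewrite scaler0 scale0r; split=> //; apply: unitaryC1.
exists (g / r%:C), (r%:C *: Hq a v); split=> //.
by rewrite scalerA mulfVK // (inj_eq (@complexI R)).
Qed.

(** The phase of the scalar is absorbed by the unitary factor. Only a real scalar can be pulled out
    of a real-linear map. *)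
Lemma inFUC_polar Z : inFUC Z -> exists (r : R) A, unitaryC A /\ Z = r%:C *: A.
Proof.
move=> [g [A [uA ->]]]; have [->|g0] := eqVneq g 0.
  by exists 0, A; rewrite !scale0r.
have /complex_realP[r er] : `|g| \is Num.real by rewrite normr_real.
exists r, ((g / `|g|) *: A); split; last first.
  by rewrite scalerA mulrC -er mulfVK // normr_eq0.
apply: unitaryCZ => //; rewrite mulrC -sqr_normc normrM normfV normr_id.
by rewrite mulfV ?normr_eq0 // expr1n.
Qed.

Lemma complexZ_Hq (s t : R) a v :
  (s +i* t) *: Hq a v = Hq (s * a) (s *: v) + 'i *: Hq (t * a) (t *: v).
Proof. by rewrite -!HqZ scalerA -scalerDl; congr (_ *: _); simpc. Qed.

(** Write [Z] and the sum as complex scalars times quaternions and compare their components in iH.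
    If both scalars are non-real, the two quaternions are proportional, and the components in H make
    [Hq b u] proportional to them as well. If one scalar is real, [Z] is a quaternion, possibly
    zero. *)
Lemma inFUC_dichotomy b u Z : Hq b u != 0 -> inFUC Z -> inFUC (Hq b u + Z) ->
  (exists a v, Z = Hq a v) \/ (exists nu, Z = nu *: Hq b u).
Proof.
move=> n0 /inFUC_Hq[[s t] [a [v eZ]]] /inFUC_Hq[[s' t'] [a' [v' eZ']]].
move: eZ'; rewrite eZ (complexZ_Hq s t) (complexZ_Hq s' t') addrA HqD.
move=> /Hq_coords[eb eu ea ev].
have [t0|t0] := eqVneq t 0.
  by left; exists (s * a), (s *: v); rewrite t0 mul0r scale0r Hq00 scaler0 addr0.
have [t'0|t'0] := eqVneq t' 0.
  left; exists 0, 0; move: ea ev; rewrite t'0 mul0r !scale0r.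
  move=> /eqP; rewrite mulf_eq0 (negPf t0) => /eqP-> /eqP.
  rewrite scaler_eq0 (negPf t0) => /eqP->.
  by rewrite !mulr0 !scaler0 Hq00 scaler0 addr0.
have a'E : a' = t / t' * a by rewrite mulrAC ea mulrAC mulfV // mul1r.
have v'E : v' = (t / t') *: v by rewrite mulrC -scalerA ev scalerA mulVf // scale1r.
pose k := s' * (t / t') - s.
have kE : Hq b u = k%:C *: Hq a v.
  rewrite HqZ; congr Hq.
    by apply: (addIr (s * a)); rewrite eb a'E /k; ring.
  by apply: (addIr (s *: v)); rewrite eu v'E scalerA -scalerDl /k subrK.
have k0 : k%:C != 0.
  by apply: contraNneq n0 => k0; rewrite kE k0 scale0r.
right; exists ((s +i* t) / k%:C).
by rewrite -complexZ_Hq kE scalerA mulfVK.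
Qed.
End Quaternions.

(** * Lifting rotations to unitary matrices *)

Section Lift.
Variable R : realType.
Local Notation C := R[i].
Local Notation M2 := 'M[C]_2.
Implicit Types (A B Z : M2) (v w : 'rV[R]_3).

Definition cross v w : 'rV[R]_3 :=
  vec3 (v 0 1 * w 0 2 - v 0 2 * w 0 1) (v 0 2 * w 0 0 - v 0 0 * w 0 2)
       (v 0 0 * w 0 1 - v 0 1 * w 0 0).

Lemma rV3E n (B : 'M[R]_(3, n)) v j :
  (v *m B) 0 j = v 0 0 * B 0 j + v 0 1 * B 1 j + v 0 2 * B 2 j.
Proof.
by rewrite mxE sum3E.
Qed.

(* Reversed orientation: [Sigma1 *m Sigma2 = - Sigma3]. *)
Lemma Hq0M v w : Hq 0 v *m Hq 0 w = Hq (- (v *m w^T) 0 0) (- cross v w).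
Proof.
have tE k : w^T k 0 = w 0 k by rewrite mxE.
have nE k : (- cross v w) 0 k = - cross v w 0 k by rewrite mxE.
rewrite !HqE mx22M !nE !vec3E rV3E !tE.
by congr mx22; simpc; congr Complex; ring.
Qed.

Lemma det3 (P : 'M[R]_3) :
  \det P = cross (row 0 P) (row 1 P) 0 0 * P 2 0
          + cross (row 0 P) (row 1 P) 0 1 * P 2 1
          + cross (row 0 P) (row 1 P) 0 2 * P 2 2.
Proof.
have rE i j : row i P 0 j = P i j by rewrite mxE.
rewrite !vec3E !rE.
(* Indexing by natural numbers makes the lifted indices of the cofactor expansions compute to the
   literal ones. *)
pose Q := fun i j : nat => P (inord i) (inord j).
have -> : P = \matrix_(i, j) Q i j.
  by apply/matrixP => i j; rewrite mxE /Q !inord_val.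
rewrite (expand_det_row _ 0) sum3E /cofactor.
rewrite !(expand_det_row _ 0) !sum2E /cofactor !det_mx11 !mxE /=.
by rewrite /bump /=; ring.
Qed.

(** The products of the cross product with the three rows are 0, 0 and [\det P = 1]; the rows being
    orthonormal, these are its coordinates. *)
Lemma cross_rows (P : 'M[R]_3) : P *m P^T = 1%:M -> \det P = 1 ->
  cross (row 0 P) (row 1 P) = row 2 P.
Proof.
move=> PP dP; set c := cross _ _.
have rE i j : row i P 0 j = P i j by rewrite mxE.
have tE i j : P^T i j = P j i by rewrite mxE.
have e : c *m P^T = delta_mx 0 2.
  by apply: rV3P; rewrite rV3E !tE [RHS]mxE /= -?dP ?det3 // /c !vec3E !rE; ring.
by rewrite -[c]mulmx1 -(mulmx1C PP) mulmxA e -rowE.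
Qed.

Lemma crossC v w : cross v w = - cross w v.
Proof. by apply: rV3P; rewrite !mxE /=; ring. Qed.

Lemma crossvv v : cross v v = 0.
Proof. by apply: rV3P; rewrite !mxE /=; ring. Qed.

Lemma HqN a v : - Hq a v = Hq (- a) (- v).
Proof. by rewrite -scaleN1r -(rmorphN1 (real_complex R)) HqZ mulN1r scaleN1r. Qed.

(** The rows of a rotation multiply by the same table as the Sigma matrices, which is the case
    [P = 1%:M]. *)
Lemma quaternion_frame (P : 'M[R]_3) (u := fun k => Hq 0 (row k P)) :
  P *m P^T = 1%:M -> \det P = 1 ->
  [/\ u 0 *m u 0 = - 1%:M, u 1 *m u 1 = - 1%:M,
      u 0 *m u 1 = - u 2 & u 1 *m u 0 = u 2].
Proof.
move=> PP dP; have c := cross_rows PP dP.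
have E i j : (row i P *m (row j P)^T) 0 0 = (i == j)%:R.
  transitivity ((P *m P^T) i j); last by rewrite PP mxE.
  by rewrite !mxE; apply: eq_bigr => k _; rewrite !mxE.
rewrite /u !Hq0M !E !crossvv !oppr0 c (crossC (row 1 P)) c opprK.
by split=> //; rewrite ?HqN ?oppr0 // -Hq_one HqN oppr0.
Qed.

(** Averaging over the quaternion group modulo sign: [q] is the sum of [g * p * h^-1] over [g] in 1,
    [u0], [u1], [u1 * u0], with [h] the corresponding product of [s0] and [s1]. The minus sign
    arises because these [h], apart from 1, square to -1. *)
Lemma intertwiner (A : pzRingType) (u0 u1 s0 s1 p : A)
    (q := p - (u0 * p * s0 + u1 * p * s1 + u1 * u0 * p * (s1 * s0))) :
  u0 * u0 = -1 -> u1 * u1 = -1 -> u0 * u1 = - (u1 * u0) ->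
  s0 * s0 = -1 -> s1 * s1 = -1 -> s0 * s1 = - (s1 * s0) ->
  u0 * q = q * s0 /\ u1 * q = q * s1.
Proof.
move=> u00 u11 u01 s00 s11 s01; rewrite /q !mulrBr !mulrBl !mulrDr !mulrDl.
have e1 : u0 * u1 * u0 = u1 by rewrite u01 mulNr -mulrA u00 mulrN1 opprK.
have e2 : s1 * s0 * s1 = s0 by rewrite -mulrA s01 mulrN mulrA s11 mulN1r opprK.
have -> : u0 * (u0 * p * s0) = - (p * s0) by rewrite !mulrA u00 mulN1r mulNr.
have -> : u0 * (u1 * p * s1) = - (u1 * u0 * p * s1) by rewrite !mulrA u01 !mulNr.
have -> : u0 * (u1 * u0 * p * (s1 * s0)) = u1 * p * (s1 * s0) by rewrite !mulrA e1.
have -> : u0 * p * s0 * s0 = - (u0 * p) by rewrite -mulrA s00 mulrN1.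
have -> : u1 * p * s1 * s0 = u1 * p * (s1 * s0) by rewrite mulrA.
have -> : u1 * u0 * p * (s1 * s0) * s0 = - (u1 * u0 * p * s1).
  by rewrite -mulrA -(mulrA s1) s00 mulrN1 mulrN.
have -> : u1 * (u0 * p * s0) = u1 * u0 * p * s0 by rewrite !mulrA.
have -> : u1 * (u1 * p * s1) = - (p * s1) by rewrite !mulrA u11 mulN1r mulNr.
have -> : u1 * (u1 * u0 * p * (s1 * s0)) = - (u0 * p * (s1 * s0)).
  by rewrite !mulrA u11 mulN1r !mulNr.
have -> : u0 * p * s0 * s1 = - (u0 * p * (s1 * s0)) by rewrite -mulrA s01 mulrN.
have -> : u1 * p * s1 * s1 = - (u1 * p) by rewrite -mulrA s11 mulrN1.
have -> : u1 * u0 * p * (s1 * s0) * s1 = u1 * u0 * p * s0 by rewrite -mulrA e2.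
rewrite !opprD !opprK; split.
  by rewrite !addrA [u0 * p + _]addrC -!addrA; congr (_ + (_ + _)); rewrite addrC.
by rewrite !addrA -[LHS]addrA [LHS]addrC !addrA.
Qed.

(* The map [p |-> p - sum_k u_k p Sigma_k] has real trace 4, hence is nonzero. *)
Lemma twisted_average_neq0 v0 v1 v2 (q : M2 -> M2) :
  (forall p, q p = p - (Hq 0 v0 *m p *m Sg R 0 + Hq 0 v1 *m p *m Sg R 1
                        + Hq 0 v2 *m p *m Sg R 2)) ->
  exists a v, q (Hq a v) != 0.
Proof.
move=> qE.
have [q0|n0] := eqVneq (q 1%:M) 0; last by exists 1, 0; rewrite Hq_one; exact: n0.
have qS k : q (Sg R k) != 0 -> exists a v, q (Hq a v) != 0.
  by move=> n0; exists 0, (delta_mx 0 k); rewrite -Sg_Hq; exact: n0.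
have [q1|/qS//] := eqVneq (q (Sg R 0)) 0.
have [q2|/qS//] := eqVneq (q (Sg R 1)) 0.
have [q3|/qS//] := eqVneq (q (Sg R 2)) 0.
exfalso; move: q0 q1 q2 q3; rewrite !qE {qS qE}.
move=> /subr0_eq q0 /subr0_eq q1 /subr0_eq q2 /subr0_eq q3.
move: q0 q1 q2 q3; rewrite mx22_1 !HqE Sg0E Sg1E Sg2E.
rewrite !mx22M !mx22D.
(* Only the diagonal coefficient in the basis 1, Sigma1, Sigma2, Sigma3 is kept from each equation:
   together they give the trace. *)
move=> q0 q1 q2 q3; have [e0 _ _ _] := mx22_inj q0.
have [_ e1 _ _] := mx22_inj q1; have [_ e2 _ _] := mx22_inj q2.
have [e3 _ _ _] := mx22_inj q3; move: e0 e1 e2 e3 => {q0 q1 q2 q3}.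
rewrite !(mulr0, mul0r, addr0, add0r, mulr1, mulrN1); simpc.
by move=> [e0 _] [_ e1] [e2 _] [_ e3]; lra.
Qed.

(** Conjugation by [U] has the required effect once [u k *m U = U *m Sg R k]. Averaging yields a
    nonzero quaternion with this property, and a real rescaling makes it unitary. *)
Lemma SO3_lift (P : 'M[R]_3) : P *m P^T = 1%:M -> \det P = 1 ->
  exists U : M2, unitaryC U /\ forall k, U *m Sg R k *m adjC U = Hq 0 (row k P).
Proof.
move=> PP dP; pose u k := Hq 0 (row k P).
have [u00 u11 u01 u10] : [/\ u 0 *m u 0 = - 1%:M, u 1 *m u 1 = - 1%:M,
    u 0 *m u 1 = - u 2 & u 1 *m u 0 = u 2] := quaternion_frame PP dP.
have [s00 s11 s01 s10] : [/\ Sg R 0 *m Sg R 0 = - 1%:M, Sg R 1 *m Sg R 1 = - 1%:M,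
    Sg R 0 *m Sg R 1 = - Sg R 2 & Sg R 1 *m Sg R 0 = Sg R 2].
  have e k : Sg R k = Hq 0 (row k 1%:M) by rewrite row1 Sg_Hq.
  by rewrite !e; apply: quaternion_frame; rewrite ?det1 // trmx1 mulmx1.
have [q qE] : exists q : M2 -> M2, forall p, q p =
    p - (u 0 *m p *m Sg R 0 + u 1 *m p *m Sg R 1 + u 2 *m p *m Sg R 2) by eexists.
have qH a v : exists b w, q (Hq a v) = Hq b w.
  rewrite qE.
  have M3 k : exists b w, u k *m Hq a v *m Sg R k = Hq b w.
    have [b [w e]] := HqM 0 (row k P) a v.
    have [c [x e']] := HqM b w 0 (delta_mx 0 k).
    by exists c, x; rewrite e Sg_Hq.
  have [b0 [w0 e0]] := M3 0; have [b1 [w1 e1]] := M3 1; have [b2 [w2 e2]] := M3 2.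
  by rewrite e0 e1 e2 !HqD HqN HqD; do 2!eexists.
have qi p : u 0 *m q p = q p *m Sg R 0 /\ u 1 *m q p = q p *m Sg R 1.
  rewrite qE -u10 -s10; apply: intertwiner => //.
    by rewrite -[u 1 * u 0]/(u 1 *m u 0) u10.
  by rewrite -[Sg R 1 * Sg R 0]/(Sg R 1 *m Sg R 0) s10.
have [a [v n0]] := twisted_average_neq0 qE.
have [b [w e]] := qH a v; rewrite e in n0.
have [r [r0 ru]] := Hq_normalize n0.
set U := _ *: _ in ru.
have [i0 i1] : u 0 *m U = U *m Sg R 0 /\ u 1 *m U = U *m Sg R 1.
  have [i0 i1] := qi (Hq a v).
  by split; rewrite /U -e -scalemxAr -scalemxAl ?i0 ?i1.
have i2 : u 2 *m U = U *m Sg R 2 by rewrite -u10 -s10 -mulmxA i0 mulmxA i1 -mulmxA.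
exists U; split; first exact: ru.
move=> k; suff e' : U *m Sg R k = u k *m U.
  by rewrite e' -mulmxA (unitaryC_adj ru) mulmx1.
by have [] := ord3P k; apply/esym.
Qed.
End Lift.

(** * Unital preservers of C U_2(C) *)

Section RealLinear.
Variables (R : realType) (L : 'M[R[i]]_2 -> 'M[R[i]]_2).
Hypothesis linL : realLinearC L.

Lemma realLinearC_D X Y : L (X + Y) = L X + L Y.
Proof. by have := linL 1 X Y; rewrite !scale1r. Qed.

Lemma realLinearC_0 : L 0 = 0.
Proof. by apply: (addrI (L 0)); rewrite -realLinearC_D !addr0. Qed.

Lemma realLinearC_Z (r : R) X : L (r%:C *: X) = r%:C *: L X.
Proof. by have := linL r X 0; rewrite realLinearC_0 !addr0. Qed.

Lemma realLinearC_Hq0 v :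
  L (Hq 0 v) = (v 0 0)%:C *: L (Sg R 0) + (v 0 1)%:C *: L (Sg R 1)
             + (v 0 2)%:C *: L (Sg R 2).
Proof.
by rewrite /Hq scale0r add0r sum3E 2!realLinearC_D 3!realLinearC_Z.
Qed.

Lemma realLinearC_Hq (a : R) v : L (Hq a v) = a%:C *: L 1%:M + L (Hq 0 v).
Proof.
rewrite -realLinearC_Z -realLinearC_D; congr L.
by rewrite -Hq_one HqZ HqD mulr1 scaler0 addr0 add0r.
Qed.
End RealLinear.

Lemma realLinearC_Hq_ext (R : realType) (L L' : 'M[R[i]]_2 -> 'M[R[i]]_2) a v :
  realLinearC L -> realLinearC L' -> L 1%:M = L' 1%:M ->
  (forall k, L (Sg R k) = L' (Sg R k)) -> L (Hq a v) = L' (Hq a v).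
Proof.
move=> lL lL' e1 eS.
rewrite (realLinearC_Hq lL) (realLinearC_Hq lL').
by rewrite (realLinearC_Hq0 lL) (realLinearC_Hq0 lL') e1 !eS.
Qed.

Lemma inFUC_preserver (R : realType) (L : 'M[R[i]]_2 -> 'M[R[i]]_2) Z :
  realLinearC L -> preservesC L -> inFUC Z -> inFUC (L Z).
Proof.
move=> linL pL /inFUC_polar[r [A [uA ->]]]; rewrite realLinearC_Z //.
have [g [W [uW ->]]] := pL _ uA.
by exists (r%:C * g), W; rewrite scalerA.
Qed.

Section UnitalPreserver.
Variables (R : realType) (L : 'M[R[i]]_2 -> 'M[R[i]]_2).
Hypotheses (linL : realLinearC L) (injL : injective L) (L1 : L 1%:M = 1%:M).
Hypothesis preL : forall Z, inFUC Z -> inFUC (L Z).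
Implicit Types (v w : 'rV[R]_3).

Let LD := realLinearC_D linL.
Let LZ := realLinearC_Z linL.

Lemma Hq_inj (a b : R) v w : Hq a v = Hq b w -> a = b /\ v = w.
Proof.
move=> e; have [|-> -> //] := @Hq_coords R a v 0 0 b w 0 0.
by rewrite e.
Qed.

Lemma Hq_real (a : R) : Hq a 0 = a%:C *: 1%:M.
Proof. by rewrite -Hq_one HqZ mulr1 scaler0. Qed.

Lemma preserver_real (a : R) : L (Hq a 0) = Hq a 0.
Proof. by rewrite Hq_real LZ L1. Qed.

Lemma Hq_neq0 (a : R) v : (a != 0) || (v != 0) -> Hq a v != 0.
Proof.
apply: contraTneq => e; have [-> ->] : a = 0 /\ v = 0.
  by apply: Hq_inj; rewrite e Hq00.
by rewrite !eqxx.
Qed.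

Lemma inFUC_Hq1 (a : R) v : inFUC (Hq a v).
Proof. by apply/inFUC_Hq; exists 1, a, v; rewrite scale1r. Qed.

Lemma preserver_Hq_dichotomy (a : R) v :
  (exists b w, L (Hq a v) = Hq b w) \/ (exists nu, L (Hq a v) = nu *: 1%:M).
Proof.
rewrite -Hq_one; apply: inFUC_dichotomy.
- by rewrite Hq_neq0 // oner_eq0.
- exact/preL/inFUC_Hq1.
- by rewrite Hq_one -L1 -LD -Hq_one HqD; apply/preL/inFUC_Hq1.
Qed.

(* Otherwise [L] would map all of H, of real dimension 4, into C. *)
Lemma preserver_Hq (a : R) v : exists b w, L (Hq a v) = Hq b w.
Proof.
case: (preserver_Hq_dichotomy a v) => // -[nu0 e0].
have [t0|t0] := eqVneq (complex.Im nu0) 0.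
  exists (complex.Re nu0), 0; rewrite e0 -Hq_one; case: nu0 t0 {e0} => s t /= ->.
  by rewrite HqZ mulr1 scaler0.
(* If [L] sent both [Hq b w] and its sum with [Hq a v] into H, the non-real scalar [nu0] would lie
   in H. *)
have LC b w : exists nu, L (Hq b w) = nu *: 1%:M.
  case: (preserver_Hq_dichotomy b w) => // -[c [x e]].
  case: (preserver_Hq_dichotomy (a + b) (v + w)) => [[d [y]]|[nu]];
    rewrite -HqD LD e0.
    rewrite e -Hq_one; case: nu0 t0 {e0} => s t /= t0.
    rewrite complexZ_Hq -[Hq d y]addr0 addrAC HqD => e'.
    have [|_ _ /eqP] :=
      @Hq_coords R (s * 1 + c) (s *: 0 + x) (t * 1) (t *: 0) d y 0 0.
      by rewrite e' Hq00 scaler0.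
    by rewrite mulr1 (negPf t0).
  by move=> e1; exists (nu - nu0); rewrite scalerBl -e1 addrC addKr.
exfalso.
have [[s1 t1] e1] := LC 0 (delta_mx 0 0); have [[s2 t2] e2] := LC 0 (delta_mx 0 1).
have K x y z : L (Hq x (vec3 y z 0)) =
    (x%:C + y%:C * (s1 +i* t1) + z%:C * (s2 +i* t2)) *: 1%:M.
  rewrite -[x]addr0 -[vec3 _ _ _]add0r -HqD LD preserver_real realLinearC_Hq0 //.
  rewrite !vec3E.
  rewrite !Sg_Hq e1 e2 scale0r addr0 !scalerDl !scalerA addrA.
  by rewrite Hq_real addr0 addrA.
have K0 x y z : x%:C + y%:C * (s1 +i* t1) + z%:C * (s2 +i* t2) = 0 -> y = 0 /\ z = 0.
  move=> e; have := K x y z; rewrite e scale0r -(realLinearC_0 linL) => /injL.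
  rewrite -(Hq00 R) => /Hq_inj[_ /rowP e'].
  by split; [have := e' 0 | have := e' 1]; rewrite !mxE.
(* The images of 1, Sigma1, Sigma2 are three vectors of the real plane C. This is the generic linear
   relation between them; it forces [t1 = 0], and then the images of 1 and Sigma1 are already
   dependent. *)
have [] := K0 (t1 * s2 - t2 * s1) t2 (- t1).
  by simpc; congr Complex; ring.
move=> _ /eqP; rewrite oppr_eq0 => /eqP t10.
have [] := K0 (- s1) 1 0.
  by rewrite t10; simpc; rewrite addNr.
by move/eqP; rewrite oner_eq0.
Qed.

(** [M] records imaginary parts only. A vector in its kernel is sent to a real number, which [L]
    fixes, so injectivity makes the vector zero. *)
Lemma preserver_Hq_matrix : exists2 M : 'M[R]_3, M \in unitmx &
  forall v, exists b, L (Hq 0 v) = Hq b (v *m M).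
Proof.
have /fin_all_exists[f fE] k : exists p : R * 'rV[R]_3, L (Sg R k) = Hq p.1 p.2.
  by have [b [w e]] := preserver_Hq 0 (delta_mx 0 k); exists (b, w); rewrite Sg_Hq.
pose M := \matrix_k (f k).2.
have ME v : exists b, L (Hq 0 v) = Hq b (v *m M).
  rewrite realLinearC_Hq0 // !fE !HqZ !HqD mulmx_sum_row sum3E !rowK.
  by eexists.
exists M => //; rewrite -row_free_unit; apply: inj_row_free => v vM.
have [b] := ME v; rewrite vM -preserver_real => /injL/Hq_inj[_ //].
Qed.

Lemma unital_preserver : exists mu (M : 'M[R]_3),
  [/\ complex.Im mu != 0, M \in unitmx, L ('i *: 1%:M) = mu *: 1%:M,
      forall v, exists b, L (Hq 0 v) = Hq b (v *m M)
    & forall v, L ('i *: Hq 0 v) = mu *: L (Hq 0 v)].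
Proof.
have [M uM ME] := preserver_Hq_matrix.
have surjL (a : R) v : exists b w, L (Hq b w) = Hq a v.
  have [c e] := ME (v *m invmx M).
  exists (a - c), (v *m invmx M).
  rewrite -[a - c]addr0 -[v *m invmx M]add0r -HqD LD preserver_real e HqD.
  by rewrite mulmxKV // subrK add0r.
(* The dichotomy is applied to [L q] and [L (i q)], whose sum is [L ((1 + i) q)]. The case of
   [L (i q)] in H = L(H) would put [i q] in H. *)
have parallel (a : R) v : Hq a v != 0 ->
    exists nu, L ('i *: Hq a v) = nu *: L (Hq a v).
  move=> n0; have [b [w e]] := preserver_Hq a v.
  case: (@inFUC_dichotomy R b w (L ('i *: Hq a v))).
  - apply: contraNneq n0 => b0; apply/eqP/injL.
    by rewrite e b0 realLinearC_0.
  - by apply: preL; apply/inFUC_Hq; exists 'i, a, v.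
  - rewrite -e -LD; apply: preL; apply/inFUC_Hq; exists (1 + 'i), a, v.
    by rewrite scalerDl scale1r.
  - move=> [c [x e1]]; have [d [y e2]] := surjL c x.
    move: e1; rewrite -e2 => /injL e1.
    have [|_ _ a0 v0] := @Hq_coords R 0 0 a v d y 0 0.
      by rewrite Hq00 add0r e1 scaler0 addr0.
    by move: n0; rewrite a0 v0 Hq00 eqxx.
  - by rewrite -e.
have [|mu] := parallel 1 0; first by rewrite Hq_neq0 // oner_eq0.
rewrite Hq_one L1 => muE.
exists mu, M; split=> // [|v].
  apply/eqP => mu0; have mur : mu *: 1%:M = Hq (complex.Re mu) 0.
    by rewrite Hq_real; case: mu mu0 {muE} => s t /= ->.
  move: muE; rewrite mur -preserver_real => /injL e.
  have [|_ _ /eqP] := @Hq_coords R 0 0 1 0 (complex.Re mu) 0 0 0.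
    by rewrite !Hq00 add0r scaler0 addr0 Hq_one.
  by rewrite oner_eq0.
have [->|v0] := eqVneq v 0.
  by rewrite Hq00 scaler0 (realLinearC_0 linL) scaler0.
(* The factors of 1, [Hq 0 v] and their sum are compared. If [nu] and [nu'] differ, [L (Hq 0 v)] is
   a scalar, so [v *m M = 0]; if they agree, both equal [mu]. *)
have [|nu e1] := parallel 0 v; first by rewrite Hq_neq0 // v0 orbT.
have [|nu'] := parallel 1 v; first by rewrite Hq_neq0 // oner_eq0.
have -> : Hq 1 v = 1%:M + Hq 0 v by rewrite -Hq_one HqD addr0 add0r.
rewrite scalerDr (LD ('i *: 1%:M)) (LD 1%:M) muE e1 L1 scalerDr => e.
have e2 : (nu - nu') *: L (Hq 0 v) = (nu' - mu) *: 1%:M.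
  apply: (addrI (mu *: 1%:M)).
  rewrite !scalerBl [LHS]addrA e [RHS]addrC subrK.
  by rewrite addrK.
have [nn|nn] := eqVneq nu nu'.
  move: e2; rewrite nn subrr scale0r => /esym/eqP; rewrite scaler_eq0 -Hq_one.
  by rewrite (negPf (Hq_neq0 _)) ?oner_eq0 // orbF subr_eq0 => /eqP->.
have [b Lv] := ME v.
have e3 : Hq b (v *m M) = ((nu - nu')^-1 * (nu' - mu)) *: 1%:M.
  by rewrite -Lv -scalerA -e2 scalerA mulVf ?scale1r // subr_eq0.
move: e3; case: (_ * _) => s t; rewrite -Hq_one complexZ_Hq => e3.
have [|_ /eqP vM _ _] :=
  @Hq_coords R b (v *m M) 0 0 (s * 1) (s *: 0) (t * 1) (t *: 0).
  by rewrite -e3 Hq00 scaler0 addr0.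
move: vM; rewrite scaler0 => /eqP vM.
by move: v0; rewrite -(mulmxK uM v) vM mul0mx eqxx.
Qed.
End UnitalPreserver.

(** * The complex case: reaching the normal form, and the converse *)

Section ComplexCase.
Variables (R : realType) (T : 'M[R[i]]_2 -> 'M[R[i]]_2).

Lemma nzFUC_unitmx (A : 'M[R[i]]_2) :
  nzFUC A -> A \in unitmx /\ inFUC (invmx A).
Proof.
move=> [g [W [g0 [uW ->]]]].
have e : (g *: W) *m (g^-1 *: adjC W) = 1%:M.
  by rewrite -scalemxAl -scalemxAr scalerA mulfV // scale1r unitaryC_adj.
have [uA _] := mulmx1_unit e; split=> //.
exists g^-1, (adjC W); split; first exact: unitaryC_adjC.
by rewrite -[LHS]mulmx1 -e mulKmx.
Qed.

Lemma nzFUC_inFUC (A : 'M[R[i]]_2) : nzFUC A -> inFUC A.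
Proof. by move=> [g [W [_ ?]]]; exists g, W. Qed.

Lemma preservesC_nzFUC : T 0 = 0 -> injective T -> preservesC T -> nzFUC (T 1%:M).
Proof.
move=> T0 injT pT; have [g [W [uW e]]] := pT _ (unitaryC1 R).
exists g, W; split=> //; apply/eqP => g0; move: e; rewrite g0 scale0r -T0.
by move/injT/matrixP/(_ 0 0)/eqP; rewrite !mxE eqxx oner_eq0.
Qed.

Lemma LmapC_linear : realLinearC T -> realLinearC (LmapC T).
Proof. by move=> lT r X Y; rewrite /LmapC lT mulmxDr -scalemxAr. Qed.

Lemma Lprime_linear U V : realLinearC T -> realLinearC (Lprime T U V).
Proof.
move=> lT r X Y; rewrite /Lprime mulmxDr mulmxDl -scalemxAr -scalemxAl.
by rewrite LmapC_linear // mulmxDr mulmxDl -scalemxAr -scalemxAl.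
Qed.

Lemma Lprime_one U V : T 1%:M \in unitmx -> unitaryC U -> unitaryC V ->
  Lprime T U V 1%:M = 1%:M.
Proof.
move=> uT uU uV; rewrite /Lprime mulmx1 unitaryC_adj // /LmapC mulVmx //.
by rewrite mulmx1 unitaryC_adj.
Qed.

(** With [P *m M = diag_mx d *m Q], the map [LmapC T] sends row [k] of [P] to [d 0 k] times row [k]
    of [Q], modulo reals. Conjugation by the lift [U] of [P] carries Sigma to the rows of [P]; the
    inverse of the lift [V] of [Q] carries the rows of [Q] back, whence [adjC V]. *)
Lemma condII_of_preservesC : realLinearC T -> injective T ->
  preservesC T -> nzFUC (T 1%:M) /\ condII T.
Proof.
move=> lT injT pT.
have nz := preservesC_nzFUC (realLinearC_0 lT) injT pT.
split=> //; have [uT iT] := nzFUC_unitmx nz.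
have injL : injective (LmapC T).
  move=> X Y e; apply: injT; rewrite -[LHS](mulKVmx uT) -[RHS](mulKVmx uT).
  by rewrite -/(LmapC T X) e.
have L1 : LmapC T 1%:M = 1%:M by rewrite /LmapC mulVmx.
have pL Z : inFUC Z -> inFUC (LmapC T Z).
  by move=> FZ; apply: inFUC_mul => //; apply: inFUC_preserver.
have [mu [M [mu0 uM Li LM LiM]]] := unital_preserver (LmapC_linear lT) injL L1 pL.
have [P [Q [d [[PP dP] [QQ dQ] PM [d10 d21 d2]]]]] := svd3 uM.
have [U [uU PU]] := SO3_lift PP dP; have [V [uV QV]] := SO3_lift QQ dQ.
exists U, (adjC V), mu.
have LS k : exists b : R, Lprime T U (adjC V) (Sg R k) =
    (d 0 k)%:C *: Sg R k + b%:C *: 1%:M.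
  have [b e] := LM (row k P); exists b.
  rewrite /Lprime PU e -row_mul PM row_mul row_diag_mx -scalemxAl -rowE.
  have -> : Hq b (d 0 k *: row k Q) = (d 0 k)%:C *: Hq 0 (row k Q) + b%:C *: 1%:M.
    by rewrite HqZ -Hq_real HqD mulr0 add0r addr0.
  rewrite mulmxDr mulmxDl adjCK -!scalemxAr -!scalemxAl mulmx1 uV -QV.
  by rewrite !mulmxA uV mul1mx -mulmxA uV mulmx1.
have LiS k : Lprime T U (adjC V) ('i *: Sg R k) = mu *: Lprime T U (adjC V) (Sg R k).
  by rewrite /Lprime -scalemxAr -scalemxAl PU LiM -scalemxAr -scalemxAl.
split; first exact: uU.
split; first exact: unitaryC_adjC.
split; first by rewrite -complexIm (inj_eq (@complexI R)).
split.
  rewrite /Lprime -scalemxAr -scalemxAl mulmx1 unitaryC_adj // Li.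
  by rewrite -scalemxAr -scalemxAl mulmx1 adjCK uV.
have [b0 e0] := LS 0; have [b1 e1] := LS 1; have [b2 e2] := LS 2.
exists (d 0 0), (d 0 1), (d 0 2), b0, b1, b2.
exact: (conj e0 (conj e1 (conj e2 (conj (LiS 0) (conj (LiS 1) (conj (LiS 2)
  (conj d10 (conj d21 d2)))))))).
Qed.

(** The normal form maps H into H and turns a factor [s + i t] of a quaternion into [s + t mu], so
    it sends scalar multiples of quaternions to such multiples; [T] differs from it only by factors
    from C U_2(C). *)
Lemma preservesC_of_condII : realLinearC T ->
  nzFUC (T 1%:M) -> condII T -> preservesC T.
Proof.
move=> lT nz [U [V [mu [uU [uV [_ [Li]]]]]]].
move=> [a1 [a2 [a3 [b1 [b2 [b3 [e1 [e2 [e3 [i1 [i2 [i3 _]]]]]]]]]]]] A uA.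
have [uT _] := nzFUC_unitmx nz; have lL := Lprime_linear U V lT.
have L1 := Lprime_one uT uU uV.
have [[s t] [a [v eA]]] : exists g a v, adjC U *m A *m U = g *: Hq a v.
  apply/unitary_Hq/unitaryCM => //; apply: unitaryCM => //.
  exact: unitaryC_adjC.
have [X XE] : exists X, X = Lprime T U V by eexists.
rewrite -XE in Li e1 e2 e3 i1 i2 i3 lL L1.
have [b [w LH]] : exists b w, X (Hq a v) = Hq b w.
  have XS k : exists b w, X (Sg R k) = Hq b w.
    have H0 (c b : R) : c%:C *: Sg R k + b%:C *: 1%:M = Hq b (c *: delta_mx 0 k).
      by rewrite Sg_Hq HqZ -Hq_real HqD mulr0 add0r addr0.
    case: (ord3P k) H0 => H0.
    - by exists b1, (a1 *: delta_mx 0 0); rewrite -H0; exact: e1.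
    - by exists b2, (a2 *: delta_mx 0 1); rewrite -H0; exact: e2.
    - by exists b3, (a3 *: delta_mx 0 2); rewrite -H0; exact: e3.
  have [c0 [w0 q0]] := XS 0; have [c1 [w1 q1]] := XS 1; have [c2 [w2 q2]] := XS 2.
  rewrite (realLinearC_Hq lL) (realLinearC_Hq0 lL) L1 q0 q1 q2.
  by rewrite -Hq_real !HqZ !HqD; do 2!eexists.
have LiH : X ('i *: Hq a v) = mu *: X (Hq a v).
  (* Both sides are real-linear in the quaternion, so it suffices to compare them on 1 and the Sigma
     matrices. *)
  have lX1 : realLinearC (fun Y => X ('i *: Y)).
    by move=> r Y Z; rewrite scalerDr scalerA mulrC -scalerA; apply: lL.
  have lX2 : realLinearC (fun Y => mu *: X Y).
    by move=> r Y Z; rewrite lL scalerDr !scalerA mulrC.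
  apply: (realLinearC_Hq_ext a v lX1 lX2); first by rewrite Li L1.
  by move=> k; case: (ord3P k); [exact: i1 | exact: i2 | exact: i3].
have LA : X (adjC U *m A *m U) = (s%:C + t%:C * mu) *: Hq b w.
  have -> : adjC U *m A *m U = s%:C *: Hq a v + t%:C *: ('i *: Hq a v).
    by rewrite eA scalerA -scalerDl; congr (_ *: _); simpc.
  by rewrite lL (realLinearC_Z lL) LiH LH scalerA -scalerDl.
have -> : T A = T 1%:M *m (adjC V *m X (adjC U *m A *m U) *m V).
  have AE : U *m (adjC U *m A *m U) *m adjC U = A.
    by rewrite !mulmxA unitaryC_adj // mul1mx -mulmxA unitaryC_adj // mulmx1.
  rewrite XE /Lprime AE !mulmxA -(mulmxA (T 1%:M)) uV mulmx1 -mulmxA uV mulmx1.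
  by rewrite mulmxV // mul1mx.
have FU B : unitaryC B -> inFUC B by exists 1, B; rewrite scale1r.
apply: inFUC_mul; first exact: nzFUC_inFUC.
apply: inFUC_mul; last exact: FU.
apply: inFUC_mul; first by apply: FU; apply: unitaryC_adjC.
by rewrite LA; apply/inFUC_Hq; exists (s%:C + t%:C * mu), b, w.
Qed.

Lemma complexLinear_mu U V mu : complexLinearC T -> injective T ->
  preservesC T -> condII_with T U V mu -> mu = 'i.
Proof.
move=> cT injT pT [uU [uV [_ [Li _]]]].
have lT : realLinearC T by move=> r; apply: cT.
have T0 := realLinearC_0 lT.
have [uT _] := nzFUC_unitmx (preservesC_nzFUC T0 injT pT).
have := Lprime_one uT uU uV; move: Li.
have TZ c X : T (c *: X) = c *: T X by have := cT c X 0; rewrite T0 !addr0.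
have -> : Lprime T U V ('i *: 1%:M) = 'i *: Lprime T U V 1%:M.
  rewrite /Lprime /LmapC -scalemxAr -scalemxAl TZ -scalemxAr -scalemxAr.
  by rewrite -scalemxAl.
move=> e L1; move: e; rewrite L1 => /matrixP/(_ 0 0).
by rewrite !mxE eqxx !mulr1.
Qed.
End ComplexCase.

(** * The real case *)

Section RealCase.
Variable R : realType.
Implicit Types A B X Y W : 'M[R]_2.

Lemma V1E X : V1 X <-> exists a b : R, X = mx22 a b (- b) a.
Proof.
suff E (a b : R) : a *: 1%:M + b *: (E2 0 1 - E2 1 0) = mx22 a b (- b) a.
  by split=> -[a [b ->]]; exists a, b; rewrite E.
by apply: mx2P; rewrite !mxE /=; ring.
Qed.

Lemma V2E X : V2 X <-> exists a b : R, X = mx22 a b b (- a).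
Proof.
suff E (a b : R) :
    a *: (E2 0 0 - E2 1 1) + b *: (E2 0 1 + E2 1 0) = mx22 a b b (- a).
  by split=> -[a [b ->]]; exists a, b; rewrite E.
by apply: mx2P; rewrite !mxE /=; ring.
Qed.

Lemma V1D X Y : V1 X -> V1 Y -> V1 (X + Y).
Proof.
move=> /V1E[a [b ->]] /V1E[c [d ->]]; apply/V1E; exists (a + c), (b + d).
by rewrite mx22D opprD.
Qed.

Lemma V1N X : V1 X -> V1 (- X).
Proof.
move=> /V1E[a [b ->]]; apply/V1E; exists (- a), (- b).
by rewrite -scaleN1r mx22Z !mulN1r.
Qed.

Lemma V2D X Y : V2 X -> V2 Y -> V2 (X + Y).
Proof.
move=> /V2E[a [b ->]] /V2E[c [d ->]]; apply/V2E; exists (a + c), (b + d).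
by rewrite mx22D opprD.
Qed.

Lemma V2N X : V2 X -> V2 (- X).
Proof.
move=> /V2E[a [b ->]]; apply/V2E; exists (- a), (- b).
by rewrite -scaleN1r mx22Z !mulN1r.
Qed.

Lemma V1_one : V1 (1%:M : 'M[R]_2).
Proof. by apply/V1E; exists 1, 0; rewrite mx22_1 oppr0. Qed.

Lemma mx22_0 : mx22 0 0 0 0 = 0 :> 'M[R]_2.
Proof. by apply: mx2P; rewrite !mxE. Qed.

Lemma V2_0 : V2 (0 : 'M[R]_2).
Proof. by apply/V2E; exists 0, 0; rewrite oppr0 mx22_0. Qed.

Lemma V12_0 X : V1 X -> V2 X -> X = 0.
Proof.
move=> /V1E[a [b ->]] /V2E[c [d e]]; have [e0 e1 e2 e3] := mx22_inj e.
have -> : a = 0 by lra.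
have -> : b = 0 by lra.
by rewrite oppr0 mx22_0.
Qed.

Lemma V12_decomp X : exists Y Z, [/\ V1 Y, V2 Z & X = Y + Z].
Proof.
rewrite [X]mx22_eta; move: (X 0 0) (X 0 1) (X 1 0) (X 1 1) => p q r s.
exists (mx22 ((p + s) / 2) ((q - r) / 2) (- ((q - r) / 2)) ((p + s) / 2)).
exists (mx22 ((p - s) / 2) ((q + r) / 2) ((q + r) / 2) (- ((p - s) / 2))).
split; [by apply/V1E; do 2!eexists | by apply/V2E; do 2!eexists |].
by rewrite mx22D; congr mx22; lra.
Qed.

(** If [Y] and [X + Y] were both in [V2], their difference [X] would lie in the trivial intersection
    of [V1] and [V2]. *)
Lemma V1_absorb X Y : V1 X -> X != 0 -> V1 Y \/ V2 Y -> V1 (X + Y) \/ V2 (X + Y) ->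
  V1 Y.
Proof.
move=> X1 X0 [//|Y2] [XY1|XY2].
  by rewrite -[Y](addKr X); apply: V1D => //; apply: V1N.
case/eqP: X0; apply: V12_0 => //; rewrite -[X](addrK Y).
by apply: V2D => //; apply: V2N.
Qed.

Lemma tr_mx22 (p q r s : R) : (mx22 p q r s)^T = mx22 p r q s.
Proof. by apply: mx2P; rewrite !mxE. Qed.

(** The determinant [D] and the first row determine the second row; [D = 1] gives [V1] and [D = -1]
    gives [V2]. *)
Lemma unitaryR_V12 W : unitaryR W -> V1 W \/ V2 W.
Proof.
move=> /mulmx1C; rewrite /unitaryR [W]mx22_eta.
move: (W 0 0) (W 0 1) (W 1 0) (W 1 1) => p q r s.
rewrite tr_mx22 mx22M mx22_1 => e; have [q00 q01 _ q11] := mx22_inj e.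
have [D DE] : exists D, D = p * s - q * r by eexists.
have sE : s = D * p.
  transitivity (s * (p * p + q * q) - q * (p * r + q * s)); last by rewrite DE; ring.
  by rewrite q00 q01; ring.
have rE : r = - (D * q).
  transitivity (r * (p * p + q * q) - p * (p * r + q * s)); last by rewrite DE; ring.
  by rewrite q00 q01; ring.
have DD : D ^+ 2 = 1.
  transitivity (D ^+ 2 * (p * p + q * q)); first by rewrite q00 mulr1.
  by rewrite -q11 sE rE; ring.
move/eqP: DD; rewrite sqrf_eq1 sE rE => {DE q01 q11 sE rE e} /orP[]/eqP->.
  by left; apply/V1E; exists p, q; rewrite !mul1r.
by right; apply/V2E; exists p, q; rewrite !mulN1r opprK.
Qed.

(** Conversely, a matrix of either space satisfies [Y^T *m Y = (a ^+ 2 + b ^+ 2) *: 1%:M], so it is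
    zero or becomes orthogonal after division by the square root. *)
Lemma inFUR_V12 X : inFUR X <-> V1 X \/ V2 X.
Proof.
split=> [[g [W [/unitaryR_V12 [/V1E|/V2E] [a [b ->]] ->]]]|].
- by left; apply/V1E; exists (g * a), (g * b); rewrite mx22Z mulrN.
- by right; apply/V2E; exists (g * a), (g * b); rewrite mx22Z mulrN.
have N0 (a b : R) : 0 <= a ^+ 2 + b ^+ 2 by rewrite addr_ge0 ?sqr_ge0.
have sc (a b : R) Y : (a ^+ 2 + b ^+ 2 = 0 -> Y = 0) ->
    Y^T *m Y = (a ^+ 2 + b ^+ 2) *: 1%:M -> inFUR Y.
  set n := _ + _ => Y0 YY; have [n0|n0] := eqVneq n 0.
    by rewrite (Y0 n0); exists 0, 1%:M; rewrite scale0r /unitaryR trmx1 mulmx1.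
  have s0 : Num.sqrt n != 0 by rewrite gt_eqF // sqrtr_gt0 lt_def n0 N0.
  exists (Num.sqrt n), ((Num.sqrt n)^-1 *: Y); split; last first.
    by rewrite scalerA mulfV // scale1r.
  have tZ c : (c *: Y)^T = c *: Y^T by apply/matrixP => i j; rewrite !mxE.
  rewrite /unitaryR tZ -scalemxAl -scalemxAr YY !scalerA.
  rewrite -{3}(sqr_sqrtr (N0 a b : 0 <= n)) expr2 mulrA mulfVK // mulVf //.
  by rewrite scale1r.
have z (a b : R) : a ^+ 2 + b ^+ 2 = 0 -> a = 0 /\ b = 0.
  move/eqP; rewrite paddr_eq0 ?sqr_ge0 // !sqrf_eq0.
  by move=> /andP[/eqP-> /eqP->].
move=> [/V1E|/V2E] [a [b ->]]; apply: (sc a b).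
- by move=> /z[-> ->]; rewrite oppr0 mx22_0.
- by rewrite tr_mx22 mx22M mx22_1 mx22Z; congr mx22; ring.
- by move=> /z[-> ->]; rewrite oppr0 mx22_0.
- by rewrite tr_mx22 mx22M mx22_1 mx22Z; congr mx22; ring.
Qed.

Lemma inFUR_mul A B : inFUR A -> inFUR B -> inFUR (A *m B).
Proof.
move=> [g [U [uU ->]]] [h [V [uV ->]]]; exists (g * h), (U *m V); split.
  by rewrite /unitaryR trmx_mul mulmxA -(mulmxA _ _ U) uU mulmx1.
by rewrite -scalemxAl -scalemxAr scalerA.
Qed.

Lemma nzFUR_unitmx A : nzFUR A -> A \in unitmx /\ inFUR (invmx A).
Proof.
move=> [g [W [g0 [uW ->]]]].
have e : (g *: W) *m (g^-1 *: W^T) = 1%:M.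
  by rewrite -scalemxAl -scalemxAr scalerA mulfV // scale1r (mulmx1C uW).
have [uA _] := mulmx1_unit e; split=> //.
exists g^-1, W^T; split; first by rewrite /unitaryR trmxK (mulmx1C uW).
by rewrite -[LHS]mulmx1 -e mulKmx.
Qed.

Section UnitalReal.
Variable L : 'M[R]_2 -> 'M[R]_2.
Hypotheses (LD : forall X Y, L (X + Y) = L X + L Y) (L1 : L 1%:M = 1%:M).
Hypothesis surjL : forall Y, exists X, L X = Y.
Hypothesis L12 : forall X, V1 X \/ V2 X -> V1 (L X) \/ V2 (L X).

Lemma preserver_V1 X : V1 X -> V1 (L X).
Proof.
move=> X1; apply: (@V1_absorb 1%:M); first exact: V1_one.
- by apply/eqP => /matrixP/(_ 0 0)/eqP; rewrite !mxE eqxx oner_eq0.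
- by apply: L12; left.
- by rewrite -L1 -LD; apply: L12; left; apply: V1D => //; apply: V1_one.
Qed.

(* Otherwise [L] maps V2, hence everything, into V1. *)
Lemma preserver_V2 X : V2 X -> V2 (L X).
Proof.
move=> X2; case: (L12 (or_intror X2)) => // X1.
have [->|LX0] := eqVneq (L X) 0; first exact: V2_0.
have all1 Y : V1 (L Y).
  have [A [B [A1 B2 ->]]] := V12_decomp Y; rewrite LD.
  apply: V1D; first exact: preserver_V1.
  (* [L X] is now a nonzero vector of [V1], and both [B] and [X + B] lie in [V2]. *)
  apply: (@V1_absorb (L X)) => //; first by apply: L12; right.
  by rewrite -LD; apply: L12; right; apply: V2D.
(* A nonzero element of [V2], which surjectivity would place in [V1]. *)
pose K : 'M[R]_2 := mx22 1 0 0 (- 1).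
have [Y eY] := surjL K; have K1 : V1 K by rewrite -eY.
have K2 : V2 K by apply/V2E; exists 1, 0.
have := V12_0 K1 K2 => /matrixP/(_ 0 0)/eqP.
by rewrite !mxE /= oner_eq0.
Qed.

(** Split a preimage along [V1] and [V2]: the image of the component outside the given space lies in
    both spaces, hence vanishes, so the other component is already a preimage. *)
Lemma preserver_onto : mapsOnto L (@V1 R) /\ mapsOnto L (@V2 R).
Proof.
have L0 : L 0 = 0 by apply: (addrI (L 0)); rewrite -LD !addr0.
split; split.
- exact: preserver_V1.
- move=> Y Y1; have [X eX] := surjL Y.
  have [A [B [A1 B2 e]]] := V12_decomp X; move: eX; rewrite e LD => eY.
  have B0 : L B = 0.
    apply: V12_0; last exact: preserver_V2.
    by rewrite -[L B](addKr (L A)) eY; apply: V1D => //; apply/V1N/preserver_V1.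
  by exists A; split=> //; rewrite -eY B0 addr0.
- exact: preserver_V2.
- move=> Y Y2; have [X eX] := surjL Y.
  have [A [B [A1 B2 e]]] := V12_decomp X; move: eX; rewrite e LD => eY.
  have A0 : L A = 0.
    apply: V12_0; first exact: preserver_V1.
    by rewrite -[L A](addrK (L B)) eY; apply: V2D => //; apply/V2N/preserver_V2.
  by exists B; split=> //; rewrite -eY A0 add0r.
Qed.
End UnitalReal.

Lemma preservesR_iff (T : 'M[R]_2 -> 'M[R]_2) :
  realLinearR T -> bijective T ->
  (preservesR T <->
   nzFUR (T 1%:M) /\ mapsOnto (LmapR T) (@V1 R) /\ mapsOnto (LmapR T) (@V2 R)).
Proof.
move=> lT bT; have injT := bij_inj bT.
have TD X Y : T (X + Y) = T X + T Y by have := lT 1 X Y; rewrite !scale1r.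
have T0 : T 0 = 0 by apply: (addrI (T 0)); rewrite -TD !addr0.
have TZ r X : T (r *: X) = r *: T X by have := lT r X 0; rewrite T0 !addr0.
split=> [pT | [nz [[m1 _] [m2 _]]] A uA].
  have nz : nzFUR (T 1%:M).
    have [|g [W [uW e]]] := pT 1%:M; first by rewrite /unitaryR trmx1 mulmx1.
    exists g, W; split=> //; apply/eqP => g0; move: e; rewrite g0 scale0r -T0.
    by move/injT/matrixP/(_ 0 0)/eqP; rewrite !mxE eqxx oner_eq0.
  have [uT iT] := nzFUR_unitmx nz; split=> //; apply: preserver_onto.
  - by move=> X Y; rewrite /LmapR TD mulmxDr.
  - by rewrite /LmapR mulVmx.
  - move=> Y; case: bT => T' _ TK; exists (T' (T 1%:M *m Y)).
    by rewrite /LmapR TK mulKmx.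
  - move=> X /inFUR_V12[g [W [uW ->]]]; apply/inFUR_V12/inFUR_mul => //.
    rewrite TZ; have [h [W' [uW' ->]]] := pT _ uW.
    by exists (g * h), W'; rewrite scalerA.
have [uT _] := nzFUR_unitmx nz.
have -> : T A = T 1%:M *m LmapR T A by rewrite /LmapR mulKVmx.
apply: inFUR_mul; first by case: nz => g [W [_ ?]]; exists g, W.
by apply/inFUR_V12; case: (unitaryR_V12 uA) => [/m1|/m2]; [left | right].
Qed.
End RealCase.

Theorem mainTheorem8 (R : realType) :
  (* F = R : case (i) *)
  (forall T : 'M[R]_2 -> 'M[R]_2,
     realLinearR T -> bijective T ->
     (preservesR T <->
        nzFUR (T 1%:M) /\ mapsOnto (LmapR T) (@V1 R) /\ mapsOnto (LmapR T) (@V2 R)))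
  /\
  (* F = C : case (ii) *)
  (forall T : 'M[R[i]]_2 -> 'M[R[i]]_2,
     realLinearC T -> bijective T ->
     (preservesC T <-> nzFUC (T 1%:M) /\ condII T))
  /\
  (* Moreover: if T is complex-linear then mu = i *)
  (forall T : 'M[R[i]]_2 -> 'M[R[i]]_2,
     complexLinearC T -> bijective T -> preservesC T ->
     forall (U V : 'M[R[i]]_2) (mu : R[i]), condII_with T U V mu -> mu = 'i).
Proof.
split; first exact: preservesR_iff.
split=> [T lT bT | T cT bT pT U V mu].
  split=> [|[nz cII]]; first exact: (condII_of_preservesC lT (bij_inj bT)).
  exact: preservesC_of_condII.
exact: (complexLinear_mu cT (bij_inj bT) pT).
Qed.
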